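(* Suppose each control function $f_i$ ($i\in\mathcal N=\{1,\dots,n\}$) is non-increasing on $\mathbb R$ and strictly decreasing and differentiable on $(-\infty,-\delta_i/2)\cup(\delta_i/2,+\infty)$. Let $\gamma_3>0$ and consider the dynamical system $\mathcal D_3$: $$v(t)=Xq(t)+\tilde v,\qquad q_i(t+1)=\Big[q_i(t)-\gamma_3\Big(q_i(t)-f_i\big(v_i(t)-v_i^{\mathrm{nom}}\big)\Big)\Big]_{\Omega_i},\quad i\in\mathcal N.$$ Then there exists a unique equilibrium point of $\mathcal D_3$. Moreover, $(v^*,q^* )$ is an equilibrium point of $\mathcal D_3$ if and only if $q^*$ is the unique optimal solution of the problem $\min_{q\in\Omega}F(q)$, where $$F(q)=\sum_{i\in\mathcal N}C_i(q_i)+\tfrac12 q^\top Xq+q^\top(\tilde v-v^{\mathrm{nom}}),$$ and $v^*=Xq^*+\tilde v$.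
   Context: Network: a tree with vertex set $\{0,1,\dots,n\}$ and edge set $\mathcal L$; each line $(h,k)\in\mathcal L$ has reactance $x_{hk}>0$. $\mathcal L_i\subseteq\mathcal L$ is the set of lines on the unique path from bus $0$ to bus $i$, and $X\in\mathbb R^{n\times n}$ is given by $X_{ij}=\sum_{(h,k)\in\mathcal L_i\cap\mathcal L_j}x_{hk}$ (a symmetric positive definite matrix). $\tilde v\in\mathbb R^n$ is a constant vector and $v^{\mathrm{nom}}=(1,\dots,1)^\top$. Feasible sets: $\Omega=\prod_{i=1}^n\Omega_i$, $\Omega_i=\{q_i: q_i^{\min}\le q_i\le q_i^{\max}\}$. For a bus with a controllable inverter, $q_i^{\max}=\min\{p_i\tan\rho_i,\sqrt{s_i^2-p_i^2}\}$ and $q_i^{\min}=-q_i^{\max}$, with constants $0\le p_i\le s_i$, $0\le\rho_i\le\pi/2$ (if $\rho_i=\pi/2$ the $\tan$ term is omitted); for a bus without one, $\Omega_i$ is a singleton. $[\cdot]_{\Omega_i}$ is the projection onto $\Omega_i$. Control functions: $f_i:\mathbb R\to\mathbb R$ is continuous, with a deadband of width $\delta_i\ge 0$ on which the control is zero: $f_i(v)=0$ for $v\in[-\delta_i/2,\delta_i/2]$ (in particular $f_i(0)=0$). Inverse and cost: $f_i^{-1}$ denotes the generalized inverse of $f_i$: for $q\ne0$ in the range of $f_i$, $f_i^{-1}(q)$ is the unique point where $f_i$ takes the value $q$, and $f_i^{-1}(0):=0$. The cost is $C_i(q_i):=-\int_0^{q_i}f_i^{-1}(q)\,dq$. It is understood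 that $\Omega_i$ is contained in the range of $f_i$, so that $F:\Omega\to\mathbb R$ is well defined and real-valued. Equilibrium: $(v^*,q^* )$ is an equilibrium point of $\mathcal D_3$ if it is a fixed point, i.e. $v^*=Xq^*+\tilde v$ and $q_i^*=[q_i^*-\gamma_3(q_i^*-f_i(v_i^*-v_i^{\mathrm{nom}}))]_{\Omega_i}$ for all $i$. *)

(* Defs.v *)
From mathcomp Require Import all_boot all_order all_algebra.
From mathcomp Require Import all_classical all_reals all_analysis.

Set Implicit Arguments.
Unset Strict Implicit.
Unset Printing Implicit Defensive.

Import Order.TTheory GRing.Theory Num.Theory.
Import numFieldNormedType.Exports.

Local Open Scope ring_scope.

(* Bus 0 is the root; a line is an unordered pair of buses, i.e. a two-element
   set. *)
Definition adjacent n (L : {set {set 'I_n.+1}}) : rel 'I_n.+1 :=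
  fun h k => [set h; k]%SET \in L.

Definition is_tree n (L : {set {set 'I_n.+1}}) : Prop :=
  [/\ {in L, forall l : {set 'I_n.+1}, #|l| = 2%N},
      (forall h k, connect (adjacent L) h k)
    & forall c : seq 'I_n.+1, (2 < size c)%N -> ~ ucycle (adjacent L) c].

Definition lines_of n (h : 'I_n.+1) (p : seq 'I_n.+1) : seq {set 'I_n.+1} :=
  pairmap (fun a b => [set a; b]%SET) h p.

(* When L is a tree, the simple path p from bus 0 to bus i is unique. *)
Definition path_lines n (L : {set {set 'I_n.+1}}) (i : 'I_n.+1)
    : {set {set 'I_n.+1}} :=
  [set l in L | `[< exists p : seq 'I_n.+1,
     [/\ path (adjacent L) ord0 p, last ord0 p = i, uniq (ord0 :: p)
       & l \in lines_of ord0 p] >]]%SET.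

(* Index i : 'I_n stands for bus i + 1, which is the vertex lift ord0 i. *)
Definition reactance_matrix (R : realType) n (L : {set {set 'I_n.+1}})
    (x : {set 'I_n.+1} -> R) : 'M[R]_n :=
  \matrix_(i, j) \sum_(l in path_lines L (lift ord0 i)
                        :&: path_lines L (lift ord0 j)) x l.

Variant bus (R : realType) :=
  | Controllable (p s rho : R)
  | Uncontrollable (q : R).

Definition bus_wf (R : realType) (b : bus R) : Prop :=
  match b with
  | Controllable p s rho => 0 <= p <= s /\ 0 <= rho <= pi / 2
  | Uncontrollable _ => True
  end.

Definition inverter_cap (R : realType) (p s rho : R) : R :=
  if rho == pi / 2 then Num.sqrt (s ^+ 2 - p ^+ 2)
  else Num.min (p * tan rho) (Num.sqrt (s ^+ 2 - p ^+ 2)).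

Definition qmax (R : realType) (b : bus R) : R :=
  match b with
  | Controllable p s rho => inverter_cap p s rho
  | Uncontrollable q => q
  end.

Definition qmin (R : realType) (b : bus R) : R :=
  match b with
  | Controllable p s rho => - inverter_cap p s rho
  | Uncontrollable q => q
  end.

Definition Omega_i (R : realType) (b : bus R) : set R :=
  [set q | qmin b <= q <= qmax b]%classic.

Definition Omega (R : realType) n (b : 'I_n -> bus R) : set 'cV[R]_n :=
  [set q | forall i, Omega_i (b i) (q i 0)]%classic.

(* Nearest point of A to x; the value is x (unused) if there is none. *)
Definition proj (R : realType) (A : set R) (x : R) : R :=
  xget x [set y | A y /\ forall z, A z -> `|x - y| <= `|x - z|]%classic.

(* The value is 0 (unused) if q is not in the range of f. *)
Definition gen_inv (R : realType) (f : R -> R) (q : R) : R :=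
  if q == 0 then 0 else xget 0 [set v | f v = q]%classic.

Definition oriented_integral (R : realType) (a b : R) (g : R -> R) : R :=
  if a <= b then Rintegral lebesgue_measure `[a, b]%classic g
  else - Rintegral lebesgue_measure `[b, a]%classic g.

Definition cost (R : realType) (f : R -> R) (q : R) : R :=
  - oriented_integral 0 q (gen_inv f).

Definition vnom (R : realType) n : 'cV[R]_n := const_mx 1.

Definition objective (R : realType) n (f : 'I_n -> R -> R) (X : 'M[R]_n)
    (vt : 'cV[R]_n) (q : 'cV[R]_n) : R :=
  \sum_i cost (f i) (q i 0) + 1 / 2 * (q^T *m X *m q) 0 0
  + (q^T *m (vt - vnom R n)) 0 0.

Definition optimal (R : realType) (T : Type) (A : set T) (F : T -> R) (q : T)
    : Prop :=
  A q /\ forall q', A q' -> F q <= F q'.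

Definition voltage (R : realType) n (X : 'M[R]_n) (vt q : 'cV[R]_n)
    : 'cV[R]_n :=
  X *m q + vt.

Definition D3_update (R : realType) n (b : 'I_n -> bus R) (f : 'I_n -> R -> R)
    (gamma : R) (v q : 'cV[R]_n) : 'cV[R]_n :=
  \col_i proj (Omega_i (b i))
    (q i 0 - gamma * (q i 0 - f i (v i 0 - vnom R n i 0))).

Definition D3_equilibrium (R : realType) n (X : 'M[R]_n) (vt : 'cV[R]_n)
    (b : 'I_n -> bus R) (f : 'I_n -> R -> R) (gamma : R) (v q : 'cV[R]_n)
    : Prop :=
  v = voltage X vt q /\ q = D3_update b f gamma v q.

(* Main.v *)
(** The vector q is an equilibrium exactly when each q_i is the projection of
    f_i(w_i) onto Omega_i, where w = X q + vt - vnom; this no longer involves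
    gamma and is the first-order optimality condition for F.  As f_i is
    non-increasing, so is its generalized inverse, and for s < t one has
    C_i(t) - C_i(s) > - v (t - s) whenever f_i(v) <= s, and the opposite strict
    inequality whenever t <= f_i(v).  Together with X being positive
    semidefinite, these two bounds show that a point satisfying the condition
    is the strict minimizer of F, and conversely that moving one coordinate of
    a minimizer violating it would decrease F.  A minimizer exists because F is
    continuous on a compact box. *)
Require Import Defs.
From mathcomp Require Import all_boot all_order all_algebra.
From mathcomp Require Import all_classical all_reals all_analysis.
From mathcomp Require Import measurable_realfun ring lra.
Import Order.TTheory GRing.Theory Num.Theory.
Import numFieldNormedType.Exports.
Local Open Scope ring_scope.

Set Implicit Arguments.
Unset Strict Implicit.
Unset Printing Implicit Defensive.

(** * Integrals of monotone functions on intervals *)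

(** Precomposing [g] with the clamp onto [[a, b]] gives a function that is non-increasing on the
    whole line, hence measurable, and the values of [g] at the endpoints bound it. *)
Lemma nonincreasing_itv_integrable (R : realType) (g : R -> R) (a b : R) :
  a <= b -> {in `[a, b] &, forall s t, s <= t -> g t <= g s} ->
  (@lebesgue_measure R).-integrable `[a, b]%classic (EFin \o g).
Proof.
move=> ab g_ni; pose clamp x := Num.max a (Num.min b x).
have clampP x : clamp x \in `[a, b].
  by rewrite in_itv/= le_max lexx ge_max ab ge_min lexx.
have ga : a \in `[a, b] by rewrite in_itv/= lexx ab.
have gb : b \in `[a, b] by rewrite in_itv/= lexx ab.
apply: measurable_bounded_integrable => //.
- by rewrite /= lebesgue_measure_itv/= lte_fin; case: ifPn => _; rewrite ?ltry.
- apply: (@eq_measurable_fun _ _ _ _ _ (g \o clamp)).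
    move=> x; rewrite inE/= in_itv/= => /andP[ax xb].
    by rewrite /clamp (min_idPr xb) (max_idPr ax).
  apply: nonincreasing_measurable => // s t st /=.
  apply: g_ni => //; rewrite /clamp ge_max; apply/andP; split.
    by rewrite le_max lexx.
  by rewrite le_max le_min !ge_min lexx st !orbT.
- exists (`|g a| + `|g b|); split; first by rewrite realE addr_ge0.
  move=> M /ltW le_M x /=; rewrite in_itv/= => xab; apply: le_trans le_M.
  have /andP[ax xb] := xab.
  have := g_ni _ _ ga xab ax; have := g_ni _ _ xab gb xb.
  have := ler_norm (g a); have := ler_norm (- g b); rewrite normrN.
  by have := normr_ge0 (g a); have := normr_ge0 (g b); rewrite ler_norml; lra.
Qed.

Lemma Rintegral_itv_add (R : realType) (g : R -> R) (a c b : R) :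
  a <= c -> c <= b ->
  (@lebesgue_measure R).-integrable `[a, b]%classic (EFin \o g) ->
  Rintegral lebesgue_measure `[a, b]%classic g =
  Rintegral lebesgue_measure `[a, c]%classic g +
  Rintegral lebesgue_measure `[c, b]%classic g.
Proof.
move=> ac cb g_int; rewrite -[X in _ + X]Rintegral_itv_obnd_cbnd; last first.
  apply: integrableS g_int => //; exact: subset_itv.
have := @Rintegral_itvB _ _ _ _ c g_int; rewrite !bnd_simp => <- //.
by rewrite addrC subrK.
Qed.

(** * The generalized inverse and increments of the cost *)

Section Cost.
Context (R : realType) (f : R -> R).
Hypothesis f_cont : continuous f.
Hypothesis f0 : f 0 = 0.
Hypothesis f_ni : forall u v, u <= v -> f v <= f u.

Lemma range_itv (a b q : R) :
  range f a -> range f b -> a <= q <= b -> range f q.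
Proof.
move=> [u _ fu] [v _ fv] /andP[aq qb].
have [vu|/ltW uv] := leP v u.
  have [||w _ fw] := @IVT R f v u q vu.
  - exact: continuous_subspaceT.
  - by rewrite fu fv ge_min le_max aq qb !orbT.
  - by exists w.
(* Here [u <= v] gives [b <= a] by monotonicity, so the interval is a single point. *)
suff -> : q = a by exists u.
by apply/eqP; rewrite eq_le aq (le_trans qb)// -fv -fu f_ni.
Qed.

Lemma range0 : range f 0. Proof. by exists 0. Qed.

Lemma gen_invK (q : R) : range f q -> f (gen_inv f q) = q.
Proof.
rewrite /gen_inv; case: eqP => [-> _ //|_ [u _ fu]].
by case: xgetP => [v -> //|/(_ u)/= /(_ fu)].
Qed.

Lemma ltr_of_f (u v : R) : f v < f u -> u < v.
Proof.
by move=> fvu; rewrite ltNge; apply/negP => /f_ni; rewrite leNgt fvu.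
Qed.

(** The strict inequality matters: where [f] is flat, [f v = s] does not tell on which side of [v]
    the chosen preimage lies. *)
Lemma gen_inv_le (s v : R) : range f s -> f v < s -> gen_inv f s <= v.
Proof. by move=> rs fv; apply/ltW/ltr_of_f; rewrite gen_invK. Qed.

Lemma gen_inv_ge (s v : R) : range f s -> s < f v -> v <= gen_inv f s.
Proof. by move=> rs fv; apply/ltW/ltr_of_f; rewrite gen_invK. Qed.

Lemma gen_inv_itv_integrable (a b : R) : a <= b -> range f a -> range f b ->
  (@lebesgue_measure R).-integrable `[a, b]%classic (EFin \o gen_inv f).
Proof.
move=> ab ra rb; apply: nonincreasing_itv_integrable => // s t.
rewrite !in_itv/= => sab tab; rewrite le_eqVlt => /predU1P[->//|st].
have rs := range_itv ra rb sab; have rt := range_itv ra rb tab.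
by apply: gen_inv_le => //; rewrite gen_invK.
Qed.

Lemma costB (a b : R) : a <= b -> range f a -> range f b ->
  cost f b - cost f a =
  - Rintegral lebesgue_measure `[a, b]%classic (gen_inv f).
Proof.
move=> ab ra rb; rewrite /cost /oriented_integral.
have int := gen_inv_itv_integrable; have r0 := range0.
have [a0|a0] := leP 0 a; have [b0|b0] := leP 0 b.
- rewrite (Rintegral_itv_add a0 ab (int _ _ b0 r0 rb)); lra.
- lra.
- rewrite (Rintegral_itv_add (ltW a0) b0 (int _ _ ab ra rb)); lra.
- rewrite (Rintegral_itv_add ab (ltW b0) (int _ _ (ltW a0) ra r0)); lra.
Qed.

(** For [s] in []a, b]] one has [f v < s], so the integrand is at most [v]. The endpoint [a] is
    dropped because [f v = a] is allowed; it has measure zero. *)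
Lemma cost_increment_ge (a b v : R) : a <= b -> range f a -> range f b ->
  f v <= a -> - v * (b - a) <= cost f b - cost f a.
Proof.
move=> ab ra rb fv; rewrite costB// mulNr lerN2.
have int := gen_inv_itv_integrable ab ra rb.
have oint : (@lebesgue_measure R).-integrable `]a, b]%classic
    (EFin \o gen_inv f).
  by apply: integrableS int => //; apply: subset_itv; rewrite bnd_simp.
have cint : (@lebesgue_measure R).-integrable `]a, b]%classic
    (EFin \o (fun=> v)).
  have vint := nonincreasing_itv_integrable (g := fun=> v) ab
    (fun _ _ _ _ _ => lexx v).
  by apply: integrableS vint => //; apply: subset_itv; rewrite bnd_simp.
rewrite -Rintegral_itv_obnd_cbnd//.
have -> : v * (b - a) = Rintegral lebesgue_measure `]a, b]%classic (fun=> v).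
  rewrite Rintegral_cst//= lebesgue_measure_itv/= lte_fin.
  by case: ltgtP ab => //= ->; rewrite subrr.
apply: le_Rintegral => //.
move=> s /=; rewrite in_itv/= => /andP[as_ sb].
apply: gen_inv_le; last exact: le_lt_trans as_.
by apply: range_itv ra rb _; rewrite (ltW as_).
Qed.

Lemma cost_increment_le (a b v : R) : a <= b -> range f a -> range f b ->
  b <= f v -> cost f b - cost f a <= - v * (b - a).
Proof.
move=> ab ra rb fv; rewrite costB// mulNr lerN2.
have int := gen_inv_itv_integrable ab ra rb.
have oint : (@lebesgue_measure R).-integrable `[a, b[%classic
    (EFin \o gen_inv f).
  by apply: integrableS int => //; apply: subset_itv; rewrite bnd_simp.
have cint : (@lebesgue_measure R).-integrable `[a, b[%classic
    (EFin \o (fun=> v)).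
  have vint := nonincreasing_itv_integrable (g := fun=> v) ab
    (fun _ _ _ _ _ => lexx v).
  by apply: integrableS vint => //; apply: subset_itv; rewrite bnd_simp.
rewrite -Rintegral_itv_bndo_bndc//.
have -> : v * (b - a) = Rintegral lebesgue_measure `[a, b[%classic (fun=> v).
  rewrite Rintegral_cst//= lebesgue_measure_itv/= lte_fin.
  by case: ltgtP ab => //= ->; rewrite subrr.
apply: le_Rintegral => //.
move=> s /=; rewrite in_itv/= => /andP[as_ sb].
apply: gen_inv_ge; last exact: lt_le_trans fv.
by apply: range_itv ra rb _; rewrite (ltW sb) as_.
Qed.

(** Strictness is gained on the upper half: a preimage [u] of the midpoint satisfies [u < v], and it
    gives the slope bound [- u] there, while [- v] serves on the lower half. *)
Lemma cost_increment_gt (a b v : R) : a < b -> range f a -> range f b ->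
  f v <= a -> - v * (b - a) < cost f b - cost f a.
Proof.
move=> ab ra rb fv; pose m := (a + b) / 2.
have rm : range f m by apply: (range_itv ra rb); rewrite /m; lra.
have [u _ fu] := rm.
have uv : u < v by apply: ltr_of_f; rewrite fu /m; lra.
have am : a <= m by rewrite /m; lra.
have mb : m <= b by rewrite /m; lra.
have fum : f u <= m by rewrite fu.
have := cost_increment_ge am ra rm fv.
have := cost_increment_ge mb rm rb fum.
have -> : b - m = (b - a) / 2 by rewrite /m; lra.
have -> : m - a = (b - a) / 2 by rewrite /m; lra.
by nra.
Qed.

Lemma cost_increment_lt (a b v : R) : a < b -> range f a -> range f b ->
  b <= f v -> cost f b - cost f a < - v * (b - a).
Proof.
move=> ab ra rb fv; pose m := (a + b) / 2.
have rm : range f m by apply: (range_itv ra rb); rewrite /m; lra.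
have [u _ fu] := rm.
have vu : v < u by apply: ltr_of_f; rewrite fu /m; lra.
have am : a <= m by rewrite /m; lra.
have mb : m <= b by rewrite /m; lra.
have fum : m <= f u by rewrite fu.
have := cost_increment_le am ra rm fum.
have := cost_increment_le mb rm rb fv.
have -> : b - m = (b - a) / 2 by rewrite /m; lra.
have -> : m - a = (b - a) / 2 by rewrite /m; lra.
by nra.
Qed.

(** On [[a, b]] the slopes of the cost lie between [- u] and [- v], for preimages [u] of [a] and [v]
    of [b], so the cost is Lipschitz there. Clamping is 1-Lipschitz and carries this to the whole
    line. *)
Lemma cost_clamp_continuous (a b : R) : a <= b -> range f a -> range f b ->
  continuous (fun s => cost f (Num.max a (Num.min b s))).
Proof.
move=> ab ra rb; have [u _ fu] := ra; have [v _ fv] := rb.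
pose clamp s := Num.max a (Num.min b s); pose K := `|u| + `|v| + 1.
have K0 : 0 < K by rewrite /K; have := normr_ge0 u; have := normr_ge0 v; lra.
have lip s t : s <= t -> `|cost f (clamp t) - cost f (clamp s)| <= K * (t - s).
  move=> st.
  have : [/\ a <= clamp s, clamp s <= clamp t, clamp t <= b
            & clamp t - clamp s <= t - s].
    by rewrite /clamp; case: (leP b s) => ?; case: (leP b t) => ?;
      rewrite ?(max_idPr ab); case: (leP a s) => ?; case: (leP a t) => ?;
      split; lra.
  move=> [as_ cst tb cts].
  have rs : range f (clamp s) by apply: (range_itv ra rb); lra.
  have rt : range f (clamp t) by apply: (range_itv ra rb); lra.
  have fus : f u <= clamp s by rewrite fu.
  have fvt : clamp t <= f v by rewrite fv.
  have := cost_increment_ge cst rs rt fus.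
  have := cost_increment_le cst rs rt fvt.
  have := ler_norm u; have := ler_norm (- v); rewrite normrN => vN uN up lo.
  have := normr_ge0 u; have := normr_ge0 v => v0 u0.
  have d0 : 0 <= clamp t - clamp s by lra.
  rewrite ler_norml /K; apply/andP; split; nra.
move=> x; apply/cvgrPdist_le => /= e e0.
near=> y; have xy : `|x - y| <= e / K.
  near: y; apply/nbhs_ballP; exists (e / K) => /=; first by rewrite divr_gt0.
  by move=> y /= /ltW.
rewrite ler_pdivlMr // mulrC in xy; apply: le_trans xy.
have [le_xy|/ltW le_yx] := leP x y.
  by rewrite distrC (distrC x) (ger0_norm (_ : 0 <= y - x)) ?subr_ge0 // lip.
by rewrite (ger0_norm (_ : 0 <= x - y)) ?subr_ge0 // lip.
Unshelve. all: by end_near. Qed.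

End Cost.

(** * Projection onto an interval *)

(* Unqualified, [proj] is the coordinate projection of MathComp-Analysis. *)
Lemma proj_itvP (R : realType) (a b x y : R) : a <= b ->
  y = Defs.proj [set q | a <= q <= b]%classic x <->
  [/\ a <= y <= b, y < b -> x <= y & a < y -> y <= x].
Proof.
move=> ab; pose c := Num.max a (Num.min b x).
have [cab cb ca] : [/\ a <= c <= b, c < b -> x <= c & a < c -> c <= x].
  by rewrite /c; case: (leP b x) => ?; rewrite ?(max_idPr ab);
    [|case: (leP a x) => ?]; split => *; lra.
(* If [z < c], then [z < b] and [a < c], whence [x <= z < c <= x]; the case [c < z] is symmetric. *)
have c_uniq z : [/\ a <= z <= b, z < b -> x <= z & a < z -> z <= x] -> z = c.
  move=> [zab zb za]; have [zc|cz|//] := ltgtP z c.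
    by have := zb (lt_le_trans zc _); have := ca (le_lt_trans _ zc); lra.
  by have := cb (lt_le_trans cz _); have := za (le_lt_trans _ cz); lra.
(* The obtuse angle at the projection [c]. *)
have c_near z : a <= z <= b -> (c - x) ^+ 2 + (z - c) ^+ 2 <= (z - x) ^+ 2.
  move=> zab; suff : 0 <= (c - x) * (z - c) by nra.
  have [xc|cx|->] := ltgtP x c; last by rewrite subrr mul0r.
    apply: mulr_ge0; first lra.
    by rewrite leNgt; apply/negP => zc; have := ca; lra.
  apply: mulr_le0; first lra.
  by rewrite leNgt; apply/negP => zc; have := cb; lra.
have -> : Defs.proj [set q | a <= q <= b]%classic x = c.
  apply: xget_unique; first split => // z zab.
    rewrite -ler_sqr ?nnegrE ?normr_ge0 ?real_normK ?num_real //.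
    by have := c_near _ zab; have := sqr_ge0 (z - c); nra.
  move=> z [zab /(_ _ cab)].
  rewrite -ler_sqr ?nnegrE ?normr_ge0 ?real_normK ?num_real // => zc.
  have : (z - c) ^+ 2 <= 0 by have := c_near _ zab; nra.
  by rewrite exprn_even_le0 //= subr_eq0 => /eqP.
by split => [->//|/c_uniq].
Qed.

(** * Expansion of the objective *)

(** For symmetric [X] this is the partial derivative in [q i 0] of the quadratic and linear terms of
    [objective]. *)
Definition voltage_error (R : realType) n (X : 'M[R]_n) (vt q : 'cV[R]_n)
    (i : 'I_n) : R :=
  voltage X vt q i 0 - vnom R n i 0.

Lemma mx11_tr_mul (R : comNzRingType) n (u v : 'cV[R]_n) :
  (u^T *m v) 0 0 = \sum_i u i 0 * v i 0.
Proof. by rewrite mxE; apply: eq_bigr => i _; rewrite mxE. Qed.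

(** An exact Taylor expansion of the quadratic part; symmetry of [X] merges the two cross terms. The
    costs stay as increments, separately in each coordinate. *)
Lemma objectiveD (R : realType) n (f : 'I_n -> R -> R) (X : 'M[R]_n)
    (vt q d : 'cV[R]_n) : X^T = X ->
  objective f X vt (q + d) - objective f X vt q =
  \sum_i (cost (f i) (q i 0 + d i 0) - cost (f i) (q i 0)
          + voltage_error X vt q i * d i 0)
  + 1 / 2 * (d^T *m X *m d) 0 0.
Proof.
move=> X_sym.
have -> : \sum_i (cost (f i) (q i 0 + d i 0) - cost (f i) (q i 0)
                  + voltage_error X vt q i * d i 0) =
    \sum_i cost (f i) ((q + d) i 0) - \sum_i cost (f i) (q i 0)
    + (d^T *m (X *m q + (vt - vnom R n))) 0 0.
  rewrite mx11_tr_mul -sumrB -big_split; apply: eq_bigr => i _ /=.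
  by rewrite /voltage_error /voltage !mxE; ring.
have dq : (d^T *m X *m q) 0 0 = (q^T *m X *m d) 0 0.
  have -> : d^T *m X *m q = (q^T *m X *m d)^T.
    by rewrite !trmx_mul trmxK X_sym mulmxA.
  by rewrite mxE.
have addE (A B : 'M[R]_1) : (A + B) 0 0 = A 0 0 + B 0 0 by rewrite mxE.
have trD : (q + d)^T = q^T + d^T by exact: linearD.
rewrite /objective trD !(mulmxDl, mulmxDr) !mulmxA !addE dq.
lra.
Qed.

Lemma quad_delta (R : comNzRingType) n (X : 'M[R]_n) (i : 'I_n) (t : R) :
  let d : 'cV[R]_n := t *: delta_mx i 0 in (d^T *m X *m d) 0 0 = t ^+ 2 * X i i.
Proof.
rewrite /= -scalemxAr linearZ /= -scalemxAl -scalemxAl scalerA mxE -expr2.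
by rewrite trmx_delta -rowE -colE !mxE.
Qed.

(** Supplies a step within the room [e] for which a quadratic term [t ^+ 2 * K] stays below a linear
    gain [c * t]. *)
Lemma small_step (R : realFieldType) (e c K : R) : 0 < e -> 0 < c ->
  exists t, [/\ 0 < t, t <= e & t * K < c].
Proof.
move=> e0 c0; pose t := Num.min e (c / (`|K| + 1)).
have K1 : 0 < `|K| + 1 by rewrite ltr_wpDl.
have t0 : 0 < t by rewrite lt_min e0 divr_gt0.
exists t; split=> //; first by rewrite ge_min lexx.
have : t <= c / (`|K| + 1) by rewrite ge_min lexx orbT.
rewrite ler_pdivlMr //; have := ler_norm K; nra.
Qed.

(** * First-order conditions and existence of a minimizer *)

Section Optimum.
Context (R : realType) (n : nat) (f : 'I_n -> R -> R) (X : 'M[R]_n).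
Context (vt : 'cV[R]_n) (lo hi : 'I_n -> R).
Hypothesis f_cont : forall i, continuous (f i).
Hypothesis f0 : forall i, f i 0 = 0.
Hypothesis f_ni : forall i u v, u <= v -> f i v <= f i u.
Hypothesis lohi : forall i, lo i <= hi i.
Hypothesis f_range : forall i q, lo i <= q <= hi i -> range (f i) q.
Hypothesis X_sym : X^T = X.
Hypothesis X_psd : forall d : 'cV[R]_n, 0 <= (d^T *m X *m d) 0 0.

Definition box := [set q : 'cV[R]_n | forall i, lo i <= q i 0 <= hi i]%classic.

(* [q i 0] is the projection of [f i (voltage_error X vt q i)] onto
   [[lo i, hi i]]. *)
Definition kkt (q : 'cV[R]_n) := forall i,
  [/\ lo i <= q i 0 <= hi i,
      q i 0 < hi i -> f i (voltage_error X vt q i) <= q i 0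
    & lo i < q i 0 -> q i 0 <= f i (voltage_error X vt q i)].

Lemma kkt_strict_min (q q' : 'cV[R]_n) : kkt q -> box q' -> q' <> q ->
  objective f X vt q < objective f X vt q'.
Proof.
move=> q_kkt q'_box q'q; rewrite -subr_gt0.
have -> : q' = q + (q' - q) by rewrite addrC subrK.
rewrite objectiveD //; set d := q' - q.
have term_gt0 i : d i 0 != 0 -> 0 < cost (f i) (q i 0 + d i 0)
    - cost (f i) (q i 0) + voltage_error X vt q i * d i 0.
  have -> : q i 0 + d i 0 = q' i 0 by rewrite /d !mxE; lra.
  have -> : d i 0 = q' i 0 - q i 0 by rewrite /d !mxE.
  have := q'_box i; have [qi up down] := q_kkt i => q'i.
  have rq := f_range qi; have rq' := f_range q'i.
  (* A decrease of coordinate [i] forces [lo i < q i 0], an increase forces [q i 0 < hi i]; so the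
     condition in [kkt] that bounds the cost increment is the one available. *)
  rewrite subr_eq0 neq_lt => /orP[lt|gt].
    have := cost_increment_lt (@f_cont i) (f0 i) (@f_ni i) lt rq' rq (down _).
    by lra.
  have := cost_increment_gt (@f_cont i) (f0 i) (@f_ni i) gt rq rq' (up _).
  by lra.
have [i di] : exists i, d i 0 != 0.
  apply: contra_notP q'q => /forallNP d0; apply/matrixP => i j.
  rewrite ord1; have /negP := d0 i; rewrite negbK /d !mxE subr_eq0.
  by move/eqP.
(* Strictness comes from a coordinate that moves; the quadratic term only has to be nonnegative. *)
apply: ltr_wpDr; first by rewrite mulr_ge0 ?X_psd.
rewrite (bigD1 i) //=; apply: ltr_wpDr; last exact: term_gt0.
apply: sumr_ge0 => j _; have [dj|] := eqVneq (d j 0) 0;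
  last by move/term_gt0/ltW.
by rewrite dj addr0 subrr mulr0 addr0.
Qed.

Lemma objective_coord (q : 'cV[R]_n) (i : 'I_n) (t : R) :
  objective f X vt (q + t *: delta_mx i 0) - objective f X vt q =
  cost (f i) (q i 0 + t) - cost (f i) (q i 0) + voltage_error X vt q i * t
  + 1 / 2 * (t ^+ 2 * X i i).
Proof.
rewrite objectiveD // quad_delta (bigD1 i) //= big1 ?addr0 => [|j /negPf ji].
  by rewrite !mxE !eqxx mulr1.
by rewrite !mxE ji /= !mulr0 !addr0 subrr.
Qed.

Lemma box_coord (q : 'cV[R]_n) (i : 'I_n) (t : R) :
  box q -> lo i <= q i 0 + t <= hi i -> box (q + t *: delta_mx i 0).
Proof.
move=> q_box qit j; rewrite !mxE andbT; case: (eqVneq j i) => [->|ji].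
  by rewrite mulr1.
by rewrite mulr0 addr0.
Qed.

Lemma optimal_kkt (q : 'cV[R]_n) : optimal box (objective f X vt) q -> kkt q.
Proof.
move=> [q_box q_min] i; set w := voltage_error X vt q i.
have qi := q_box i; have rq := f_range qi.
have no_descent t : lo i <= q i 0 + t <= hi i ->
    0 <= cost (f i) (q i 0 + t) - cost (f i) (q i 0) + w * t
         + 1 / 2 * (t ^+ 2 * X i i).
  by move=> /(box_coord q_box)/q_min; rewrite -subr_ge0 objective_coord.
split=> // [q_hi|q_lo]; rewrite leNgt; apply/negP => fw.
(* The bound [- w] on the cost slope would merely cancel the term [w * t]. A preimage [u] of a value
   [m] strictly between [q i 0] and [f i w] has [w < u], so as long as [q i 0 + t <= m] the
   first-order terms sum to at most [- (u - w) * t], which beats the quadratic term for small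
   [t]. *)
- pose m := (q i 0 + Num.min (f i w) (hi i)) / 2.
  have [qm mf mh] : [/\ q i 0 < m, m < f i w & m <= hi i].
    by rewrite /m; case: (leP (f i w) (hi i)) => ?; split; lra.
  have [u _ fu] : range (f i) m by apply: f_range; lra.
  have wu : w < u by apply: (ltr_of_f (@f_ni i)); rewrite fu.
  have [||t [t0 tm tK]] := @small_step R (m - q i 0) (u - w) (X i i); try lra.
  have qt : q i 0 <= q i 0 + t by lra.
  have rt : range (f i) (q i 0 + t) by apply: f_range; lra.
  have fut : q i 0 + t <= f i u by lra.
  have := cost_increment_le (@f_cont i) (f0 i) (@f_ni i) qt rq rt fut.
  have := no_descent t; have -> : q i 0 + t - q i 0 = t by lra.
  have -> : lo i <= q i 0 + t <= hi i by lra.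
  by move=> /(_ isT); nra.
(* The mirror image, with a downward step and [u < w]. *)
- pose m := (q i 0 + Num.max (f i w) (lo i)) / 2.
  have [qm mf mh] : [/\ m < q i 0, f i w < m & lo i <= m].
    by rewrite /m; case: (leP (f i w) (lo i)) => ?; split; lra.
  have [u _ fu] : range (f i) m by apply: f_range; lra.
  have uw : u < w by apply: (ltr_of_f (@f_ni i)); rewrite fu.
  have [||t [t0 tm tK]] := @small_step R (q i 0 - m) (w - u) (X i i); try lra.
  have qt : q i 0 - t <= q i 0 by lra.
  have rt : range (f i) (q i 0 - t) by apply: f_range; lra.
  have fut : f i u <= q i 0 - t by lra.
  have := cost_increment_ge (@f_cont i) (f0 i) (@f_ni i) qt rt rq fut.
  have := no_descent (- t); have -> : q i 0 - (q i 0 - t) = t by lra.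
  have -> : lo i <= q i 0 - t <= hi i by lra.
  by move=> /(_ isT); nra.
Qed.

Lemma optimal_exists : exists q, optimal box (objective f X vt) q.
Proof.
pose clamp i s := Num.max (lo i) (Num.min (hi i) s).
(* With clamped costs, [F] is continuous on all row vectors, also where the cost itself is
   uncontrolled, and it agrees with the objective on the box. Rows are the form in which
   [rV_compact] and [EVT_min_rV] apply. *)
pose F (r : 'rV[R]_n) := \sum_i cost (f i) (clamp i (r 0 i))
  + 1 / 2 * (\sum_j (\sum_i r 0 i * X i j) * r 0 j)
  + \sum_i r 0 i * (vt - vnom R n) i 0.
have FE (r : 'rV[R]_n) : box r^T -> F r = objective f X vt r^T.
  move=> r_box; rewrite /F /objective mx11_tr_mul; congr (_ + _ * _ + _).
  - apply: eq_bigr => i _; have := r_box i; rewrite mxE => /andP[ri ir].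
    by rewrite /clamp (min_idPr ir) (max_idPr ri).
  - rewrite mxE; apply: eq_bigr => j _; rewrite !mxE; congr (_ * _).
    by apply: eq_bigr => i _; rewrite !mxE.
  - by apply: eq_bigr => i _; rewrite !mxE.
have coord i : continuous (fun r : 'rV[R]_n => r 0 i)
  by exact: coord_continuous.
have sum_cont (G : 'I_n -> 'rV[R]_n -> R) : (forall i, continuous (G i)) ->
    continuous (fun r => \sum_i G i r).
  by move=> G_cont; apply: continuous_big => //; exact: add_continuous.
have add_cont (G H : 'rV[R]_n -> R) : continuous G -> continuous H ->
    continuous (fun r => G r + H r).
  by move=> G_cont H_cont r; exact: (continuousD (@G_cont r) (@H_cont r)).
have mul_cont (G H : 'rV[R]_n -> R) : continuous G -> continuous H ->
    continuous (fun r => G r * H r).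
  by move=> G_cont H_cont r; exact: (continuousM (@G_cont r) (@H_cont r)).
have F_cont : continuous F.
  have cst_cont (k : R) : continuous (fun _ : 'rV[R]_n => k).
    exact: cst_continuous.
  apply: (add_cont); first apply: (add_cont).
  - apply: (sum_cont) => i r.
    have rlo : range (f i) (lo i) by apply: f_range; rewrite lexx lohi.
    have rhi : range (f i) (hi i) by apply: f_range; rewrite lexx lohi.
    have C_cont := cost_clamp_continuous (@f_cont i) (f0 i) (@f_ni i)
      (lohi i) rlo rhi.
    exact: (continuous_comp (@coord i r) (@C_cont (r 0 i))).
  - apply: (mul_cont) => //; apply: (sum_cont) => j; apply: (mul_cont) => //.
    by apply: (sum_cont) => i; apply: (mul_cont).
  - by apply: (sum_cont) => i; apply: (mul_cont).
pose A := [set r : 'rV[R]_n | forall i, `[lo i, hi i]%classic (r 0 i)]%classic.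
have AP r : A r <-> box r^T.
  by split=> rA i; have := rA i; rewrite /= mxE in_itv.
have A_compact : compact A.
  apply: (rV_compact (A := fun i => `[lo i, hi i]%classic)) => i.
  exact: segment_compact.
have A0 : (A !=set0)%classic.
  by exists (\row_i lo i) => i /=; rewrite mxE in_itv /= lexx lohi.
have [r rA r_min] := EVT_min_rV A0 A_compact (continuous_subspaceT F_cont).
move: rA; rewrite inE => /AP r_box.
exists r^T; split=> // q q_box.
have q_box' : box q^T^T by rewrite trmxK.
rewrite -(trmxK q) -!FE //; apply: r_min; rewrite inE; exact/AP.
Qed.

End Optimum.

(** * Feasible intervals and the reactance matrix *)

Lemma tan_ge0 (R : realType) (x : R) : 0 <= x < pi / 2 -> 0 <= tan x.
Proof.
move=> /andP[x0 xpi]; have pi0 := pi_gt0 R; rewrite /tan divr_ge0 //.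
  by rewrite sin_ge0_pi //; lra.
by rewrite ltW // cos_gt0_pihalf //; lra.
Qed.

Lemma qmin_le_qmax (R : realType) (b : bus R) : bus_wf b -> qmin b <= qmax b.
Proof.
case: b => [p s rho [/andP[p0 _] /andP[r0 r_pi]]|q _] //=.
suff : 0 <= inverter_cap p s rho by lra.
rewrite /inverter_cap; case: eqVneq => [_|r_neq]; first exact: sqrtr_ge0.
by rewrite le_min sqrtr_ge0 mulr_ge0 // tan_ge0 // r0 lt_neqAle r_neq.
Qed.

Lemma reactance_matrix_sym (R : realType) n (L : {set {set 'I_n.+1}})
    (x : {set 'I_n.+1} -> R) :
  (reactance_matrix L x)^T = reactance_matrix L x.
Proof. by apply/matrixP => i j; rewrite !mxE finset.setIC. Qed.

(** Indicators of the paths exhibit the matrix as a Gram matrix weighted by the reactances. *)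
Lemma reactance_matrixE (R : realType) n (L : {set {set 'I_n.+1}})
    (x : {set 'I_n.+1} -> R) (i j : 'I_n) :
  reactance_matrix L x i j =
  \sum_(l in L) x l * (l \in path_lines L (lift ord0 i))%:R
                     * (l \in path_lines L (lift ord0 j))%:R.
Proof.
rewrite mxE big_mkcond [RHS]big_mkcond; apply: eq_bigr => l _; rewrite !inE.
by case: (l \in L); case: asbool; case: asbool; rewrite /= ?mulr1 ?mulr0 ?mul0r.
Qed.

Lemma reactance_matrix_psd (R : realType) n (L : {set {set 'I_n.+1}})
    (x : {set 'I_n.+1} -> R) (d : 'cV[R]_n) :
  (forall l, l \in L -> 0 < x l) ->
  0 <= (d^T *m reactance_matrix L x *m d) 0 0.
Proof.
move=> x_gt0; pose P i l : R := (l \in path_lines L (lift ord0 i))%:R.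
(* Each line contributes its reactance times the square of the sum of [d] over the buses whose path
   from the root uses it. *)
have -> : (d^T *m reactance_matrix L x *m d) 0 0 =
    \sum_(l in L) x l * (\sum_i P i l * d i 0) ^+ 2.
  under [RHS]eq_bigr => l _ do rewrite expr2 mulr_sumr mulr_sumr.
  rewrite mxE exchange_big; apply: eq_bigr => j _ /=.
  rewrite mxE mulr_suml.
  under [RHS]eq_bigr => l _ do rewrite mulr_suml mulr_sumr.
  rewrite exchange_big; apply: eq_bigr => i _ /=.
  rewrite reactance_matrixE mulr_sumr mulr_suml; apply: eq_bigr => l _.
  by rewrite mxE -/(P i l) -/(P j l); ring.
apply: sumr_ge0 => l lL; apply: mulr_ge0; last exact: sqr_ge0.
exact/ltW/x_gt0.
Qed.

(** * Equilibria and minimizers *)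

Theorem theorem6 (R : realType) (n : nat)
    (L : {set {set 'I_n.+1}}) (x : {set 'I_n.+1} -> R)
    (vt : 'cV[R]_n) (b : 'I_n -> bus R)
    (delta : 'I_n -> R) (f : 'I_n -> R -> R) (gamma : R)
    (L_tree : is_tree L)
    (x_gt0 : forall l, l \in L -> 0 < x l)
    (b_wf : forall i, bus_wf (b i))
    (delta_ge0 : forall i, 0 <= delta i)
    (f_cont : forall i, continuous (f i))
    (f_deadband : forall i v, - (delta i / 2) <= v <= delta i / 2 -> f i v = 0)
    (Omega_range : forall i q, Omega_i (b i) q -> exists v, f i v = q)
    (f_nonincr : forall i u v, u <= v -> f i v <= f i u)
    (f_decr : forall i u v,
      (u < - (delta i / 2) \/ delta i / 2 < u) ->
      (v < - (delta i / 2) \/ delta i / 2 < v) ->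
      u < v -> f i v < f i u)
    (f_diff : forall i v,
      (v < - (delta i / 2) \/ delta i / 2 < v) -> derivable (f i) v 1)
    (gamma_gt0 : 0 < gamma) :
  let X := reactance_matrix L x in
  let F := objective f X vt in
  (exists! vq : 'cV[R]_n * 'cV[R]_n,
     D3_equilibrium X vt b f gamma vq.1 vq.2) /\
  (forall v q : 'cV[R]_n,
     D3_equilibrium X vt b f gamma v q <->
     unique (optimal (Omega b) F) q /\ v = voltage X vt q).
Proof.
move=> X F; pose lo i := qmin (b i); pose hi i := qmax (b i).
have f0 i : f i 0 = 0 by apply: f_deadband; have := delta_ge0 i; lra.
have lohi i : lo i <= hi i by exact: qmin_le_qmax.
have f_range i q : lo i <= q <= hi i -> range (f i) q.
  by move=> /Omega_range[v fv]; exists v.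
have X_sym : X^T = X by exact: reactance_matrix_sym.
have X_psd (d : 'cV[R]_n) : 0 <= (d^T *m X *m d) 0 0
  by exact: reactance_matrix_psd.
have equilibriumP v q : D3_equilibrium X vt b f gamma v q <->
    v = voltage X vt q /\ kkt f X vt lo hi q.
  split=> -[-> q_fix]; split=> //.
    move=> i; set w := f i _.
    have /(proj_itvP _ _ (lohi i))[qi up down] :
        q i 0 = Defs.proj (Omega_i (b i)) (q i 0 - gamma * (q i 0 - w)).
      by rewrite [LHS](congr1 (fun u : 'cV[R]_n => u i 0) q_fix) mxE.
    (* The projection conditions compare [q i 0] with [q i 0 - gamma * (q i 0 - w)]; dividing by
       [gamma > 0] turns this into a comparison of [q i 0] with [w]. *)
    split=> // [/up|/down]; nra.
  apply/matrixP => i j; rewrite ord1 mxE; have [qi up down] := q_fix i.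
  apply/(proj_itvP _ _ (lohi i)); split=> // [/up|/down];
    rewrite /voltage_error; nra.
have kkt_min q : kkt f X vt lo hi q -> unique (optimal (Omega b) F) q.
  move=> q_kkt; have lt q' := kkt_strict_min f_cont f0 f_nonincr f_range
    X_sym X_psd q_kkt (q' := q').
  have q_opt : optimal (Omega b) F q.
    split=> [i|q' q'_box]; first by case: (q_kkt i).
    by have [->//|/eqP q'q] := eqVneq q' q; apply/ltW/lt.
  split=> // q' [q'_box q'_min]; apply: contrapT => /nesym q'q.
  have := lt _ q'_box q'q; rewrite ltNge => /negP; apply.
  by apply: q'_min; case: q_opt.
have min_kkt q : optimal (Omega b) F q -> kkt f X vt lo hi q.
  exact: optimal_kkt.
have [q q_opt] : exists q, optimal (Omega b) F q by exact: optimal_exists.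
split; last first.
  move=> v p; rewrite equilibriumP; split=> [[-> /kkt_min]//|[[p_opt _] ->]].
  by split=> //; exact: min_kkt.
(* The minimizer provides the equilibrium. Any other equilibrium has a [kkt] point as its second
   component, which is the unique minimizer, and this determines its voltage. *)
exists (voltage X vt q, q); split=> [|[v p] /=]; rewrite equilibriumP.
  by split=> //; exact: min_kkt.
by move=> [-> /kkt_min[_ /(_ _ q_opt) ->]].
Qed.
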